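(* Let $(A,\diamond,\circ,\sigma)$ be a skew truss. Fix an element $e\in A$ and define a new group operation on $A$ by $a\diamond_e b := a\diamond e^\diamond\diamond b$. Then $(A,\diamond_e,\circ)$ is a skew truss with the cocycle $\sigma_e: A\to A$, $\sigma_e(a) = a\circ e$.
   Context: A skew (left) truss is a quadruple $(A,\diamond,\circ,\sigma)$ where $(A,\diamond)$ is a group (the inverse of $a$ is denoted $a^\diamond$), $(A,\circ)$ is a semigroup and $\sigma:A\to A$ is a function, called the cocycle, such that for all $a,b,c\in A$, $a\circ(b\diamond c) = (a\circ b)\diamond\sigma(a)^\diamond\diamond(a\circ c)$. *)

(* Defs.v *)
From mathcomp Require Import all_boot.

Set Implicit Arguments.
Unset Strict Implicit.
Unset Printing Implicit Defensive.

(* Groups are given by unbundled operations rather than by MathComp's          *)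
(* groupType: a single carrier bears several group structures here, and        *)
(* groupType would require the carrier to be a choiceType.                     *)
Record is_group (A : Type) (mul : A -> A -> A) (one : A) (inv : A -> A) : Prop :=
  IsGroup {
    is_group_assoc : associative mul;
    is_group_left_id : left_id one mul;
    is_group_right_id : right_id one mul;
    is_group_left_inv : left_inverse one inv mul;
    is_group_right_inv : right_inverse one inv mul
  }.

(* [one] and [inv] are the neutral element and the inverse a |-> a^dia of dia, *)
(* and [sigma] is the cocycle.                                                 *)
Record is_skew_truss (A : Type) (dia : A -> A -> A) (one : A) (inv : A -> A)
    (circ : A -> A -> A) (sigma : A -> A) : Prop :=
  IsSkewTruss {
    skew_truss_group : is_group dia one inv;
    skew_truss_semigroup : associative circ;
    skew_truss_distr : forall a b c : A,
      circ a (dia b c) = dia (dia (circ a b) (inv (sigma a))) (circ a c)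
  }.

Definition shifted_op (A : Type) (dia : A -> A -> A) (inv : A -> A) (e : A)
    (a b : A) : A :=
  dia (dia a (inv e)) b.

(* Main.v *)
Require Import Defs.
From mathcomp Require Import all_boot.

(* The group (A, dia_e) is (A, dia) transported along a |-> a dia e, so its    *)
(* neutral element is e and its inverse a |-> e dia a^dia dia e. As            *)
(* sigma(a) = a circ 1, expanding a circ (e dia e^dia) = sigma(a) gives        *)
(* sigma(a)^dia dia (a circ e^dia) dia sigma(a)^dia = (a circ e)^dia, which    *)
(* turns the two cocycle factors in a circ (b dia e^dia dia c) into one.       *)

Section Group.

Context {A : Type} {mul : A -> A -> A} {one : A} {inv : A -> A}.
Context (hG : is_group mul one inv).

Lemma is_group_mulI : right_injective mul.
Proof.
case: hG => mA m1 _ mV _ x y z exy.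
by rewrite -[y]m1 -[z]m1 -(mV x) -!mA exy.
Qed.

Lemma is_group_mulKV x : cancel (mul x) (mul (inv x)).
Proof. by case: hG => mA m1 _ mV _ y; rewrite mA mV m1. Qed.

Lemma is_group_mulVK x : cancel (mul (inv x)) (mul x).
Proof. by case: hG => mA m1 _ _ mV y; rewrite mA mV m1. Qed.

Lemma is_group_shifted e :
  is_group (shifted_op mul inv e) e (fun a => mul (mul e (inv a)) e).
Proof.
have [mA m1 mr1 mV mrV] := hG.
split; rewrite /shifted_op => x.
- by move=> y z; rewrite !mA.
- by rewrite mrV m1.
- by rewrite -mA mV mr1.
- by rewrite -!mA is_group_mulVK mV mr1.
- by rewrite -!mA is_group_mulKV is_group_mulVK.
Qed.

End Group.

Section SkewTruss.

Context {A : Type} {dia : A -> A -> A} {one : A} {inv : A -> A}.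
Context {circ : A -> A -> A} {sigma : A -> A}.
Context (hA : is_skew_truss dia one inv circ sigma).

Let hG : is_group dia one inv := skew_truss_group hA.

(** With [b = c = one] the distributive law reads [x = dia (dia x (inv (sigma a))) x] for
    [x = circ a one]; cancel [x]. *)
Lemma skew_truss_circ_one a : circ a one = sigma a.
Proof.
have [mA m1 mr1 mV mrV] := hG.
apply: (is_group_mulI hG (inv (sigma a))).
apply: (is_group_mulI hG (circ a one)).
by rewrite mA -(skew_truss_distr hA) mV m1 mr1.
Qed.

Lemma skew_truss_circ_inv a e :
  dia (dia (inv (sigma a)) (circ a (inv e))) (inv (sigma a)) = inv (circ a e).
Proof.
have [mA _ _ _ mrV] := hG.
apply: (is_group_mulI hG (circ a e)).
(* The left factor [circ a e] lets the law be read backwards, producing [circ a (dia e (inv e))]. *)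
by rewrite !mA -(skew_truss_distr hA) !mrV skew_truss_circ_one mrV.
Qed.

End SkewTruss.

Theorem corollary2p8 (A : Type) (dia : A -> A -> A) (one : A) (inv : A -> A)
    (circ : A -> A -> A) (sigma : A -> A)
    (hA : is_skew_truss dia one inv circ sigma) (e : A) :
  exists (one_e : A) (inv_e : A -> A),
    is_skew_truss (shifted_op dia inv e) one_e inv_e circ (fun a : A => circ a e).
Proof.
have [hG cA cD] := hA; have [mA _ _ _ _] := hG.
exists e, (fun a => dia (dia e (inv a)) e); split=> //.
  exact: (is_group_shifted hG).
move=> a b c; rewrite /shifted_op !cD -(skew_truss_circ_inv hA) -!mA.
(* On the right, the shifted inverse of [circ a e] carries an [e] on each side; the two [inv e] of
   the shifted products cancel them. *)
by rewrite !(is_group_mulKV hG) !(is_group_mulVK hG).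
Qed.
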